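(* For every positive integer $m$, $$0 = \sum_{j=0}^{m} (-4)^j \left[ \frac{B_{4m-4j+2}}{(4m-4j+2)!} \frac{B_{4j}}{(4j)!} + 2\, \frac{B_{4m-4j}}{(4m-4j)!} \frac{B_{4j+2}}{(4j+2)!} \right].$$
   Context: $B_n$ denotes the $n$-th Bernoulli number ($B_0 = 1$, $B_2 = 1/6$, $B_4 = -1/30$, ...). *)

(* Defs.v *)
From mathcomp Require Import all_boot all_order all_algebra.

Set Implicit Arguments.
Unset Strict Implicit.
Unset Printing Implicit Defensive.

Import GRing.Theory.
Local Open Scope ring_scope.

(* The list B_0, ..., B_(n-1), each entry being obtained by solving
   \sum_(k < m.+1) 'C(m.+1, k) * B_k = (m == 0) for its last unknown B_m;
   this is t = (e^t - 1) * \sum_n B_n t^n / n! read coefficientwise. *)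
Fixpoint bernoulli_seq (n : nat) : seq rat :=
  if n is m.+1 then
    let s := bernoulli_seq m in
    rcons s (((m == 0)%N%:R - \sum_(k < m) 'C(m.+1, k)%:R * s`_k) / m.+1%:R)
  else [::].

Definition bernoulli (n : nat) : rat := (bernoulli_seq n.+1)`_n.

Lemma size_bernoulli_seq n : size (bernoulli_seq n) = n.
Proof. by elim: n => //= n IHn; rewrite size_rcons IHn. Qed.

Lemma nth_bernoulli_seq n k : (k < n)%N -> (bernoulli_seq n)`_k = bernoulli k.
Proof.
elim: n => // n IHn; rewrite ltnS leq_eqVlt => /predU1P[-> //|lt_kn].
by rewrite /= nth_rcons size_bernoulli_seq lt_kn IHn.
Qed.

Lemma bernoulli_rec n :
  \sum_(k < n.+1) 'C(n.+1, k)%:R * bernoulli k = (n == 0)%N%:R.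
Proof.
rewrite big_ord_recr /= binSn {2}/bernoulli /= nth_rcons.
rewrite size_bernoulli_seq ltnn eqxx mulrC divfK ?Num.Theory.pnatr_eq0 //.
rewrite addrC -[RHS](subrK (\sum_(k < n) 'C(n.+1, k)%:R * bernoulli k)).
congr (_ - _ + _); apply: eq_bigr => k _.
by rewrite nth_bernoulli_seq.
Qed.

(* Main.v *)
Require Import Defs.
From mathcomp Require Import all_boot all_order all_algebra.
From mathcomp Require Import algC qpoly ring zify.

Import GRing.Theory Num.Theory.
Local Open Scope ring_scope.

(* Write F(z) = (z/2) coth(z/2), the generating function of the B_n / n! with
   the n = 1 term removed; it is even.  Since (1 + i)^4 = -4 and
   (1 + i)^2 = 2i, four times the sum is the coefficient of z^(4m+2) in
     (F(z) - F(iz)) (F(wz) + F(iwz)) - i (F(z) + F(iz)) (F(wz) - F(iwz))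
   with w = 1 + i.  As coth(a z / 2) = (e^(az) + 1) / (e^(az) - 1), the
   relation e^(wz) = e^z e^(iz) turns this into a rational identity, and the
   expression is exactly z^2.  Power series are taken modulo 'X^N, i.e. in
   {poly %/ 'X^N}. *)

(** * The algebraic identity between the four values of F *)

(* Here [e], [v], [e * v], [e * (e * v)] are the exponentials of [z],
   [(I - 1) z], [I z] and [(1 + I) z]; the four factors to be cancelled are
   not invertible, each of them having a simple zero at z = 0. *)
Lemma coth_identity (A : comPzRingType) (I z e v f1 f2 f3 f4 : A) :
  I ^+ 2 = -1 ->
  2 * f1 * (e - 1) = z * (e + 1) ->
  2 * f2 * (e * v - 1) = I * z * (e * v + 1) ->
  2 * f3 * (e * (e * v) - 1) = (1 + I) * z * (e * (e * v) + 1) ->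
  2 * f4 * (v - 1) = (I - 1) * z * (v + 1) ->
  (e - 1) * ((e * v - 1) * ((e * (e * v) - 1) * ((v - 1) *
    (4 * ((1 - I) * f1 * f3 + (1 + I) * f1 * f4
        - (1 + I) * f2 * f3 - (1 - I) * f2 * f4 - z * z))))) = 0.
Proof.
move=> I2 H1 H2 H3 H4.
transitivity
  ((1 - I) * (2 * f1 * (e - 1)) * (2 * f3 * (e * (e * v) - 1))
     * ((e * v - 1) * (v - 1))
 + (1 + I) * (2 * f1 * (e - 1)) * (2 * f4 * (v - 1))
     * ((e * v - 1) * (e * (e * v) - 1))
 - (1 + I) * (2 * f2 * (e * v - 1)) * (2 * f3 * (e * (e * v) - 1))
     * ((e - 1) * (v - 1))
 - (1 - I) * (2 * f2 * (e * v - 1)) * (2 * f4 * (v - 1))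
     * ((e - 1) * (e * (e * v) - 1))
 - 4 * z ^+ 2 * ((e - 1) * ((e * v - 1) * ((e * (e * v) - 1) * (v - 1)))));
  first by ring.
rewrite {}H1 {}H2 {}H3 {}H4.
transitivity (z ^+ 2 * (
   (1 - I ^+ 2) * ((e + 1) * (e * (e * v) + 1) * ((e * v - 1) * (v - 1)))
 + (I ^+ 2 - 1) * ((e + 1) * (v + 1) * ((e * v - 1) * (e * (e * v) - 1)))
 - (I + 2 * I ^+ 2 + I * I ^+ 2)
     * ((e * v + 1) * (e * (e * v) + 1) * ((e - 1) * (v - 1)))
 + (I - 2 * I ^+ 2 + I * I ^+ 2)
     * ((e * v + 1) * (v + 1) * ((e - 1) * (e * (e * v) - 1)))
 - 4 * ((e - 1) * (e * v - 1) * (e * (e * v) - 1) * (v - 1)))); first by ring.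
(* The four coefficients become 2, -2, 2, 2, so [I] drops out and a polynomial identity in [e] and
   [v] remains. *)
by rewrite I2; ring.
Qed.

(** * Polynomials modulo a power of ['X] and truncated exponentials *)

Lemma in_qpoly_Xn_eq0_dvdp {R : fieldType} {n : nat} {p : {poly R}} :
  in_qpoly 'X^(n.+1) p = 0 -> 'X^(n.+1) %| p.
Proof.
move=> /(congr1 (fun q : {poly %/ _} => q : {poly R})) /=.
rewrite mk_monic_Xn // -(Pdiv.IdomainMonic.modpE (monicXn _ _)).
by move/eqP.
Qed.

Lemma eq_in_qpoly_Xn {R : fieldType} {n : nat} {p q : {poly R}} :
  (forall i, (i < n.+1)%N -> p`_i = q`_i) ->
  in_qpoly 'X^(n.+1) p = in_qpoly 'X^(n.+1) q.
Proof.
move=> eq_pq; apply: val_inj => /=; rewrite mk_monic_Xn.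
rewrite -!(Pdiv.IdomainMonic.modpE (monicXn _ _)).
rewrite -!Pdiv.IdomainMonic.take_poly_modp.
by apply/polyP=> i; rewrite !coef_take_poly; case: ifP => // /eq_pq.
Qed.

Definition exp_poly {R : fieldType} n (a : R) : {poly R} :=
  \poly_(k < n.+1) (a ^+ k / k`!%:R).

Lemma exp_polyD {R : numFieldType} n (a b : R) :
  in_qpoly 'X^(n.+1) (exp_poly n (a + b)) =
  in_qpoly 'X^(n.+1) (exp_poly n a) * in_qpoly 'X^(n.+1) (exp_poly n b).
Proof.
rewrite -in_qpolyM; apply: eq_in_qpoly_Xn => i lt_in.
rewrite coefM coef_poly lt_in addrC exprDn mulr_suml.
apply: eq_bigr => k _; rewrite !coef_poly.
have le_ki : (k <= i)%N by rewrite -ltnS.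
rewrite (leq_ltn_trans le_ki) // (leq_ltn_trans (leq_subr k i)) //.
have nz j : j`!%:R != 0 :> R by rewrite pnatr_eq0 -lt0n fact_gt0.
rewrite -(bin_fact le_ki) !natrM -mulr_natl.
have := nz k; have := nz (i - k)%N.
have : 'C(i, k)%:R != 0 :> R by rewrite pnatr_eq0 -lt0n bin_gt0.
by move=> ? ? ?; field; do ![apply/andP; split].
Qed.

(** The first factor is ['X] times a polynomial with constant term [a], which is coprime to ['X].
    Cancelling it thus costs exactly one power of ['X]. *)
Lemma dvdp_exp_polyB1 {R : numFieldType} {n m : nat} {a : R} {p : {poly R}} :
  a != 0 -> 'X^(m.+1) %| (exp_poly n.+1 a - 1) * p -> 'X^m %| p.
Proof.
move=> a0.
have -> : exp_poly n.+1 a - 1 = 'X * \poly_(k < n.+1) (a ^+ k.+1 / k.+1`!%:R).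
  apply/polyP=> [[|k]]; rewrite coefB coef1 coefXM !coef_poly /=.
    by rewrite expr0 fact0 divr1 subrr.
  by rewrite subr0 ltnS.
rewrite exprS -mulrA dvdp_mul2l ?polyX_eq0 // Gauss_dvdpr //.
apply: coprimep_expl; rewrite coprimep_sym -['X]subr0 -polyC0 coprimep_XsubC.
by rewrite /root horner_coef0 coef_poly /= divr1 expr1.
Qed.

(** * The generating function of the Bernoulli numbers *)

Definition bern_coef (R : numFieldType) n : R := ratr (bernoulli n / n`!%:R).

(** Dividing the recurrence for [bernoulli] by (n+1)! turns the binomial sum into a convolution with
    the coefficients of e^t - 1. *)
Lemma bern_coef_rec (R : numFieldType) n :
  \sum_(k < n.+1) bern_coef R k / (n.+1 - k)`!%:R = (n == 0)%N%:R.
Proof.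
have nz j : j`!%:R != 0 :> rat by rewrite pnatr_eq0 -lt0n fact_gt0.
transitivity
  (ratr (\sum_(k < n.+1) 'C(n.+1, k)%:R * bernoulli k / n.+1`!%:R) : R).
  rewrite rmorph_sum; apply: eq_bigr => k _.
  rewrite /bern_coef -(ratr_nat R (_ - _)`!) -fmorph_div /=; congr ratr.
  have le_kn : (k <= n.+1)%N by rewrite ltnW.
  rewrite -(bin_fact le_kn) !natrM.
  have := nz k; have := nz (n.+1 - k)%N.
  have : 'C(n.+1, k)%:R != 0 :> rat by rewrite pnatr_eq0 -lt0n bin_gt0.
  by move=> ? ? ?; field; do ![apply/andP; split].
rewrite -mulr_suml bernoulli_rec; case: n => [|n] /=.
  by rewrite divr1 ratr_nat.
by rewrite mul0r rmorph0.
Qed.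

(* The truncation of (az/2) coth(az/2); the linear term cancels the one coming
   from B_1 = -1/2. *)
Definition coth_poly {R : numFieldType} n (a : R) : {poly R} :=
  \poly_(k < n.+1) (a ^+ k * bern_coef R k) + (a / 2)%:P * 'X.

(** The Bernoulli series G satisfies G (e^(az) - 1) = az. Doubling this and adding az (e^(az) - 1),
    the contribution of the linear term az/2, gives az (e^(az) + 1). *)
Lemma coth_polyP {R : numFieldType} n (a : R) :
  2 * in_qpoly 'X^(n.+1) (coth_poly n a)
    * (in_qpoly 'X^(n.+1) (exp_poly n a) - 1)
  = in_qpoly 'X^(n.+1) a%:P * in_qpoly 'X^(n.+1) 'X
    * (in_qpoly 'X^(n.+1) (exp_poly n a) + 1).
Proof.
set G := \poly_(k < n.+1) (a ^+ k * bern_coef R k).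
have GE : in_qpoly 'X^(n.+1) (G * (exp_poly n a - 1)) =
          in_qpoly 'X^(n.+1) (a%:P * 'X).
  apply: eq_in_qpoly_Xn => i lt_in.
  rewrite coefM coefCM coefX big_ord_recr /= subnn.
  (* The last term of the convolution vanishes, which leaves the range of [bern_coef_rec]. *)
  have -> : (exp_poly n a - 1)`_0 = 0.
    by rewrite coefB coef1 coef_poly /= expr0 divr1 subrr.
  rewrite mulr0 addr0.
  case: i lt_in => [|i] lt_in; first by rewrite big_ord0 mulr0.
  transitivity (a ^+ i.+1 * \sum_(k < i.+1) bern_coef R k / (i.+1 - k)`!%:R).
    rewrite mulr_sumr; apply: eq_bigr => k _.
    have lt_ki := ltn_ord k.
    rewrite coefB coef1 !coef_poly subn_eq0 (leqNgt i.+1) lt_ki subr0.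
    rewrite (ltn_trans lt_ki) // (leq_ltn_trans (leq_subr _ _)) //.
    have -> : a ^+ i.+1 = a ^+ k * a ^+ (i.+1 - k).
      by rewrite -exprD subnKC // ltnW.
    by ring.
  by rewrite bern_coef_rec; case: i {lt_in} => [|i]; rewrite ?expr1 ?mulr0.
have aE : in_qpoly 'X^(n.+1) a%:P = 2 * in_qpoly 'X^(n.+1) (a / 2)%:P.
  rewrite -(rmorph_nat (in_qpoly 'X^(n.+1)) 2) -rmorphM /= -polyC_natr -polyCM.
  by congr (in_qpoly _ _%:P); field.
move: GE; rewrite !rmorphM rmorphB rmorph1 /= => GE.
rewrite /coth_poly -/G rmorphD rmorphM /=.
move: GE; rewrite aE.
set g := in_qpoly _ G; set e := in_qpoly _ (exp_poly n a).
set c := in_qpoly _ _%:P; set x := in_qpoly _ 'X => GE.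
transitivity (2 * (g * (e - 1)) + 2 * c * x * (e - 1)); first by ring.
by rewrite GE; ring.
Qed.


Lemma coef_coth_poly {R : numFieldType} {n k : nat} (a : R) : (k < n.+2)%N ->
  (coth_poly n.+1 a)`_k = a ^+ k * (bern_coef R k + (k == 1)%N%:R / 2).
Proof.
move=> lt_kn; rewrite coefD coef_poly lt_kn coefCM coefX mulrDr.
by case: eqP => [->|_]; rewrite ?mul0r ?mulr0 // expr1 mulr1 mul1r.
Qed.

Lemma coef_dvdp_Xn {R : fieldType} {n k : nat} {p : {poly R}} :
  'X^n %| p -> (k < n)%N -> p`_k = 0.
Proof. by case/dvdpP=> q -> lt_kn; rewrite coefMXn lt_kn. Qed.

(** F is even: the equations for F(z) and F(-z) agree because e^z e^(-z) = 1. *)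
Lemma bern_coef_odd (R : numFieldType) k :
  odd k -> bern_coef R k + (k == 1)%N%:R / 2 = 0.
Proof.
move=> odd_k; pose F : R -> {poly R} := coth_poly k.+1.
have dvd0 : 'X^(k.+2) %| (exp_poly k.+1 1 - 1) * (2 * (F 1 - F (-1))).
  apply: in_qpoly_Xn_eq0_dvdp; rewrite !(rmorphM, rmorphB, rmorph1, rmorph_nat) /=.
  have H1 := coth_polyP k.+1 (1 : R); have H2 := coth_polyP k.+1 (-1 : R).
  have := exp_polyD k.+1 (1 : R) (-1).
  have -> : exp_poly k.+1 (1 - 1 : R) = 1.
    rewrite subrr; apply/polyP=> -[|i]; rewrite coef_poly coef1 //=.
      by rewrite expr0 divr1.
    by rewrite expr0n mul0r if_same.
  rewrite rmorph1; move: H1 H2; rewrite polyCN rmorphN !rmorph1 -!/(F _) /=.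
  set e := in_qpoly _ (exp_poly _ 1); set v := in_qpoly _ (exp_poly _ _).
  set f := in_qpoly _ (F 1); set g := in_qpoly _ (F _); set x := in_qpoly _ 'X.
  move=> H1 H2 ev.
  (* Since e v = 1, multiplying v - 1 by e gives 1 - e, so both equations share the factor e - 1. *)
  transitivity (2 * f * (e - 1) + e * (2 * g * (v - 1))
                + (1 - e * v) * (2 * g)).
    by ring.
  rewrite H1 H2 -ev subrr mul0r addr0.
  transitivity (x * (1 - e * v)); first by ring.
  by rewrite -ev subrr mulr0.
have := coef_dvdp_Xn (dvdp_exp_polyB1 (oner_neq0 R) dvd0) (ltnSn k).
rewrite mulr_natl coefMn coefB !coef_coth_poly //.
rewrite expr1n -signr_odd odd_k expr1 mul1r mulN1r opprK -mulr2n.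
by move/eqP; rewrite !mulrn_eq0 /= => /eqP.
Qed.

(** * Extraction of the coefficient of z^(4m+2) *)

Lemma bern_coef_sum (R : numFieldType) (i : R) m (f : nat -> R) :
    i ^+ 2 = -1 -> (0 < m)%N ->
    (forall k, f k = bern_coef R k + (k == 1)%N%:R / 2) ->
  \sum_(k < (4 * m + 2).+1)
    ((1 + i) ^+ k * ((1 - i) + (1 + i) * i ^+ k)
       - i ^+ (4 * m + 2 - k) * (1 + i) ^+ k * ((1 + i) + (1 - i) * i ^+ k))
     * (f (4 * m + 2 - k)%N * f k) = 0.
Proof.
move=> i2 m_gt0 fE; set n := (4 * m + 2)%N.
(* The four extra degrees pay for cancelling four factors with a simple zero. *)
pose E : R -> {poly R} := exp_poly n.+4.
pose F : R -> {poly R} := coth_poly n.+4.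
(* The expanded product of the overview minus z^2, with i w = i - 1. *)
pose P := (1 - i)%:P * F 1 * F (1 + i) + (1 + i)%:P * F 1 * F (i - 1)
  - (1 + i)%:P * F i * F (1 + i) - (1 - i)%:P * F i * F (i - 1) - 'X * 'X.
have dvd0 : 'X^(n.+4.+1) %|
    (E 1 - 1) * ((E i - 1) * ((E (1 + i) - 1) * ((E (i - 1) - 1) * (4 * P)))).
  apply: in_qpoly_Xn_eq0_dvdp.
  have Ei : in_qpoly 'X^(n.+4.+1) (E i) = 
      in_qpoly 'X^(n.+4.+1) (E 1) * in_qpoly 'X^(n.+4.+1) (E (i - 1)).
    by rewrite -exp_polyD addrC subrK.
  have H1 := coth_polyP n.+4 (1 : R); have H2 := coth_polyP n.+4 i.
  have H3 := coth_polyP n.+4 (1 + i); have H4 := coth_polyP n.+4 (i - 1).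
  have E1i := exp_polyD n.+4 1 i.
  move: E1i Ei H1 H2 H3 H4; rewrite /P /E /F {P E F}.
  move: (@exp_poly R n.+4) (@coth_poly R n.+4) => E F.
  rewrite polyC1 rmorph1 mul1r.
  rewrite !(rmorph1, rmorph_nat, polyCN, polyCD, rmorphN, rmorphM, rmorphD) /=.
  move=> -> ->; set I := in_qpoly _ i%:P => H1 H2 H3 H4.
  apply: coth_identity H1 H2 H3 H4.
  by rewrite /I -rmorphXn -polyC_exp i2 polyCN rmorphN rmorph1.
have i0 : i != 0.
  apply: contra_eq_neq i2 => ->.
  by rewrite expr0n /= eq_sym oppr_eq0 oner_eq0.
have /andP[i1 i1'] : (1 + i != 0) && (i - 1 != 0).
  rewrite -negb_or -mulf_eq0.
  have -> : (1 + i) * (i - 1) = i ^+ 2 - 1 by ring.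
  by rewrite i2 -opprD oppr_eq0 -(natrD _ 1 1) pnatr_eq0.
have /coef_dvdp_Xn/(_ (ltnSn n)) : 'X^(n.+1) %| 4 * P.
  apply: (dvdp_exp_polyB1 i1'); apply: (dvdp_exp_polyB1 i1).
  apply: (dvdp_exp_polyB1 i0); apply: (dvdp_exp_polyB1 (oner_neq0 R)).
  exact: dvd0.
have coefFF c a b : (c%:P * F a * F b)`_n = \sum_(k < n.+1)
    c * (a ^+ (n - k) * b ^+ k) * (f (n - k)%N * f k).
  rewrite -mulrA coefCM coefMr mulr_sumr; apply: eq_bigr => k _.
  have lt_kn : (k < n.+4.+1)%N := leq_trans (ltn_ord k) (leq_addl 4 n.+1).
  have lt_nkn : (n - k < n.+4.+1)%N :=
    leq_ltn_trans (leq_subr k n) (leq_addl 4 n.+1).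
  by rewrite !coef_coth_poly // -!fE; ring.
rewrite mulr_natl coefMn !coefB coefD !coefFF -expr2 coefXn.
(* Here 0 < m is used: z^2 does not contribute in degree 4m + 2. *)
have -> : (n == 2)%N = false by rewrite /n; lia.
rewrite subr0 => /eqP; rewrite mulrn_eq0 /= => /eqP sum0; rewrite -[RHS]sum0.
rewrite -big_split -!sumrB /=.
apply: eq_bigr => k _.
rewrite !expr1n.
have -> : i - 1 = i * (1 + i) by rewrite mulrDr mulr1 -expr2 i2.
by rewrite exprMn; ring.
Qed.

(** Even indices are separated modulo 4 because i^k is 1 at 4j and -1 at 4j + 2. *)
Lemma big_ord_odd0 (V : zmodType) (g : nat -> V) m :
  (forall k, odd k -> g k = 0) ->
  \sum_(k < (4 * m + 2).+1) g k =
  \sum_(0 <= j < m.+1) (g (4 * j)%N + g (4 * j + 2)%N).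
Proof.
move=> g0; elim: m => [|m IHm].
  by rewrite !big_ord_recr big_ord0 big_nat1 /= add0r (g0 1) ?addr0.
have -> : (4 * m.+1 + 2)%N = (4 * m + 2).+4 by lia.
rewrite 4!big_ord_recr IHm [RHS]big_nat_recr //= -!addrA.
congr (_ + _).
rewrite g0 ?add0r; last by lia.
rewrite addrCA (g0 (4 * m + 2).+3) ?add0r; last by lia.
by congr (g _ + g _); lia.
Qed.

Theorem theorem10 (m : nat) (hm : (0 < m)%N) :
  0 = \sum_(0 <= j < m.+1)
        (- 4) ^+ j *
        (bernoulli (4 * m - 4 * j + 2) / (4 * m - 4 * j + 2)`!%:R *
           (bernoulli (4 * j) / (4 * j)`!%:R) +
         2 * (bernoulli (4 * m - 4 * j) / (4 * m - 4 * j)`!%:R) *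
           (bernoulli (4 * j + 2) / (4 * j + 2)`!%:R)).
Proof.
pose f k : algC := bern_coef algC k + (k == 1)%N%:R / 2.
have f_odd k : odd k -> f k = 0 by exact: bern_coef_odd.
have f_even k : ~~ odd k -> f k = bern_coef algC k.
  by case: k => [|[|k]] //= _; rewrite /f mul0r addr0.
have i2 : 'i ^+ 2 = -1 :> algC by rewrite sqrCi.
apply: (fmorph_inj (@ratr algC)); rewrite rmorph0.
pose g k : algC :=
  ((1 + 'i) ^+ k * ((1 - 'i) + (1 + 'i) * 'i ^+ k)
    - 'i ^+ (4 * m + 2 - k) * (1 + 'i) ^+ k * ((1 + 'i) + (1 - 'i) * 'i ^+ k))
  * (f (4 * m + 2 - k)%N * f k).
have sum0 : \sum_(k < (4 * m + 2).+1) g k = 0.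
  exact: bern_coef_sum i2 hm (fun=> erefl).
rewrite big_ord_odd0 in sum0; last first.
  by move=> k /f_odd fk0; rewrite /g fk0 !mulr0.
(* Each pair g(4j) + g(4j + 2) is four times the j-th summand. *)
have mulr4n_inj0 (x : algC) : x *+ 4 = 0 -> x = 0.
  by move/eqP; rewrite mulrn_eq0 => /eqP.
apply/esym/mulr4n_inj0.
rewrite -[RHS]sum0 !big_mkord rmorph_sum /= -sumrMnl.
apply/eq_bigr => j _.
rewrite /g; have le_jm : (4 * j <= 4 * m)%N by rewrite leq_mul2l /= -ltnS.
have -> : (4 * m + 2 - 4 * j = 4 * m - 4 * j + 2)%N by lia.
have -> : (4 * m + 2 - (4 * j + 2) = 4 * m - 4 * j)%N by lia.
rewrite !f_even; try lia.
rewrite /bern_coef.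
(* The quotients become atoms, so that [ratr] is not distributed inside them. *)
have [b bE] : {b : nat -> rat | forall k, bernoulli k / k`!%:R = b k}.
  by exists (fun k => bernoulli k / k`!%:R).
rewrite {f g f_odd f_even sum0} !bE.
rewrite !(rmorph_nat, rmorphXn, rmorphN, rmorphM, rmorphD) /=.
have i4 k : 'i ^+ (4 * k) = 1 :> algC.
  by rewrite exprM (exprM _ 2 2) i2 sqrrN !expr1n.
have w2 : (1 + 'i) ^+ 2 = 2 * 'i :> algC.
  by transitivity (1 + 2 * 'i + 'i ^+ 2 : algC); [ring | rewrite i2; ring].
have w4 : (1 + 'i) ^+ (4 * j) = (- 4) ^+ j :> algC.
  by rewrite exprM (exprM _ 2 2) w2; congr (_ ^+ _); rewrite exprMn i2; ring.
rewrite !(exprD _ _ 2) !i2 -mulnBr !i4 w2 w4.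
set u := ratr _; set v := ratr _; set x := ratr _; set y := ratr _.
(* At 4j the weight is (-4)^j (2 + 2); at 4j + 2 it is (-4)^j 2i (-2i - 2i), that is 8 (-4)^j,
   whence the factor 2 in the theorem. *)
transitivity ((- 4) ^+ j * (4 * (u * v) - 8 * 'i ^+ 2 * (x * y))); last by ring.
by rewrite i2; ring.
Qed.
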